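(* Let $q$ be an odd prime power and let $Q$ be a nondegenerate quadratic form on $\mathbb{F}_q^d$. Let $P \subseteq \mathbb{F}_q^d$, and let $S$ be a set of $Q$-spheres such that every $s \in S$ has exactly $|s| = q^{d-1} + N$ points, for a fixed constant $N$. Let $p = q^{-1} + q^{-d}N$. Then \[\left(I(P,S) - p|P|\,|S|\right)^2 \leq |P|\sum_{\substack{s_1, s_2 \in S\\ s_1 \neq s_2}}\left(|s_1 \cap s_2| - q^d p^2\right) + |P|\,|S|\,(q^{d-1} + N),\] where the sum is over ordered pairs of distinct spheres.
   Context: $\mathbb{F}_q$ is the finite field with $q$ elements. A quadratic form $Q(x) = \sum_{i,j} a_{ij}x_ix_j$ with $a_{ij}=a_{ji}$ is nondegenerate if the matrix $(a_{ij})$ is non-singular. The $Q$-sphere with center $y \in \mathbb{F}_q^d$ and radius $r \in \mathbb{F}_q$ is the set $\{x \in \mathbb{F}_q^d : Q(x-y) = r\}$; a sphere is specified by its center and radius. For $P \subseteq \mathbb{F}_q^d$ and a set $S$ of spheres, $I(P,S) = \#\{(x,s) \in P \times S : x \in s\}$. *)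

(* Defs.v *)
From mathcomp Require Import all_boot all_order all_algebra.
Set Implicit Arguments.
Unset Strict Implicit.
Unset Printing Implicit Defensive.
Import Order.TTheory GRing.Theory Num.Theory.
Local Open Scope ring_scope.

Definition qform (F : finFieldType) (d : nat) (A : 'M[F]_d) (x : 'rV[F]_d) : F :=
  \sum_i \sum_j A i j * x 0 i * x 0 j.

Definition nondegenerate_qform (F : finFieldType) (d : nat) (A : 'M[F]_d) : bool :=
  (A^T == A) && (A \in unitmx).

(* A sphere is its data (center, radius): distinct data count as distinct
   spheres even when the underlying point sets coincide. *)
Definition sphere (F : finFieldType) (d : nat) : finType :=
  ('rV[F]_d * F)%type.

Definition sphere_points (F : finFieldType) (d : nat) (A : 'M[F]_d)
    (s : sphere F d) : {set 'rV[F]_d} :=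
  [set x | qform A (x - s.1) == s.2].

Definition incidences (F : finFieldType) (d : nat) (A : 'M[F]_d)
    (P : {set 'rV[F]_d}) (S : {set sphere F d}) : nat :=
  #|[set xs in setX P S | xs.1 \in sphere_points A xs.2]|.

(* Main.v *)
Require Import Defs.
From mathcomp Require Import all_boot all_order all_algebra.
From mathcomp Require Import ring.
Set Implicit Arguments.
Unset Strict Implicit.
Unset Printing Implicit Defensive.
Import Order.TTheory GRing.Theory Num.Theory.
Local Open Scope ring_scope.

(* Summing f(x) - p|S| over x in P, where f(x) is the number of spheres of S
   through x, gives I(P,S) - p|P||S|. By Cauchy-Schwarz its square is at most
   |P| times the second moment of f - p|S| over the whole space, and p is the
   density of each sphere, so this second moment is the sum of
   |s1 :&: s2| - q^d p^2 over all ordered pairs (s1, s2). The diagonal pairs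
   contribute |S|(q^(d-1) + N) - |S| q^d p^2. *)

(** Cauchy-Schwarz against the constant 1, obtained from Lagrange's identity: the squares (g x - g
    y)^2 summed over all pairs in P give twice the gap between the two sides. *)
Lemma sqr_sum_le_card (R : realDomainType) (X : finType) (P : {set X})
    (g : X -> R) :
  (\sum_(x in P) g x) ^+ 2 <= #|P|%:R * \sum_(x in P) g x ^+ 2.
Proof.
have: 0 <= \sum_(x in P) \sum_(y in P) (g x - g y) ^+ 2.
  by do 2!apply: sumr_ge0 => ? _; exact: sqr_ge0.
set G := \sum_(x in P) g x; set H := \sum_(x in P) g x ^+ 2.
have -> : \sum_(x in P) \sum_(y in P) (g x - g y) ^+ 2 =
    2 * (#|P|%:R * H - G ^+ 2).
  transitivity (\sum_(x in P) (#|P|%:R * g x ^+ 2 - 2 * G * g x + H)).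
    apply: eq_bigr => x _.
    under eq_bigr => y _ do rewrite sqrrB.
    rewrite !big_split /= sumrN sumr_const sumrMnl -mulr_sumr -/G -/H.
    ring.
  rewrite !big_split /= sumrN sumr_const -!mulr_sumr -/G -/H.
  ring.
by rewrite pmulr_rge0 ?ltr0n // subr_ge0.
Qed.

Lemma card_set_sum (R : pzSemiRingType) (X : finType) (E : {set X}) :
  #|E|%:R = \sum_x (x \in E)%:R :> R.
Proof. by rewrite -sum1_card natr_sum big_mkcond; apply: eq_bigr => x _; case: ifP. Qed.

(** Double counting of triples (x, s1, s2) with x in both sets; the pairs with s1 = s2 are
    included. *)
Lemma sum_incidence_sqr (R : comPzSemiRingType) (X B : finType)
    (E : B -> {set X}) (S : {set B}) :
  \sum_x (\sum_(s in S) (x \in E s)%:R) ^+ 2 =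
  \sum_(s1 in S) \sum_(s2 in S) #|E s1 :&: E s2|%:R :> R.
Proof.
under eq_bigr => x _.
  rewrite expr2 mulr_suml.
  under eq_bigr => s1 _ do rewrite mulr_sumr.
  over.
rewrite exchange_big; apply: eq_bigr => s1 _.
rewrite exchange_big; apply: eq_bigr => s2 _.
by rewrite card_set_sum; apply: eq_bigr => x _; rewrite inE -natrM mulnb.
Qed.

Lemma card_incidences (R : pzSemiRingType) (X B : finType)
    (E : B -> {set X}) (P : {set X}) (S : {set B}) :
  #|[set xs in setX P S | xs.1 \in E xs.2]|%:R =
  \sum_(x in P) \sum_(s in S) (x \in E s)%:R :> R.
Proof.
rewrite pair_big_dep /= -sum1_card natr_sum big_mkcond [RHS]big_mkcond /=.
by apply: eq_bigr => -[x s] _; rewrite !inE /=; do 3!case: (_ \in _).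
Qed.

(** Only the common density p of the sets matters, not their geometry. An indexed family [E] lets
    different indices carry the same point set, as spheres may. *)
Lemma incidence_variance (R : realDomainType) (X B : finType)
    (E : B -> {set X}) (P : {set X}) (S : {set B}) (p : R)
    (E_card : forall s, s \in S -> #|E s|%:R = #|X|%:R * p) :
  (#|[set xs in setX P S | xs.1 \in E xs.2]|%:R - p * #|P|%:R * #|S|%:R) ^+ 2
  <= #|P|%:R * (\sum_(s1 in S) \sum_(s2 in S) #|E s1 :&: E s2|%:R
                - #|X|%:R * p ^+ 2 * #|S|%:R ^+ 2).
Proof.
pose f x : R := \sum_(s in S) (x \in E s)%:R.
pose g x := f x - p * #|S|%:R.
(* Thus f has mean p|S| over X, and the cross term of the expanded square of [g] is minus twice its
   constant term. *)
have sum_f : \sum_x f x = #|S|%:R * (#|X|%:R * p).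
  rewrite exchange_big /= (eq_bigr (fun=> #|X|%:R * p)).
    by rewrite sumr_const -[LHS]mulr_natl.
  by move=> s sS; rewrite -card_set_sum E_card.
have -> : #|[set xs in setX P S | xs.1 \in E xs.2]|%:R - p * #|P|%:R * #|S|%:R
    = \sum_(x in P) g x.
  rewrite card_incidences sumrB sumr_const; congr (_ - _).
  by rewrite -[RHS]mulr_natl mulrCA mulrA.
have <- : \sum_x g x ^+ 2 = \sum_(s1 in S) \sum_(s2 in S) #|E s1 :&: E s2|%:R
    - #|X|%:R * p ^+ 2 * #|S|%:R ^+ 2.
  under eq_bigr => x _ do rewrite sqrrB.
  rewrite !big_split /= sum_incidence_sqr sumrN sumr_const sumrMnl -mulr_suml.
  rewrite sum_f.
  ring.
apply: le_trans (sqr_sum_le_card P g) _.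
apply: ler_wpM2l; first exact: ler0n.
(* Passing from P to all of X only adds squares. *)
rewrite [leRHS](bigID (mem P)) /= lerDl.
by apply: sumr_ge0 => x _; exact: sqr_ge0.
Qed.

Theorem theorem2p3 (R : realFieldType) (q : nat) (F : finFieldType)
    (q_card : #|F| = q) (q_odd : odd q) (d : nat)
    (A : 'M[F]_d) (A_nondeg : nondegenerate_qform A)
    (P : {set 'rV[F]_d}) (S : {set sphere F d}) (N : R)
    (S_card : forall s, s \in S ->
       #|sphere_points A s|%:R = q%:R ^ (d%:Z - 1) + N) :
  let p : R := q%:R^-1 + q%:R ^- d * N in
  ((incidences A P S)%:R - p * #|P|%:R * #|S|%:R) ^+ 2 <=
    #|P|%:R * (\sum_(s1 in S) \sum_(s2 in S | s1 != s2)
        (#|sphere_points A s1 :&: sphere_points A s2|%:R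
           - q%:R ^+ d * p ^+ 2))
    + #|P|%:R * #|S|%:R * (q%:R ^ (d%:Z - 1) + N).
Proof.
cbv zeta; set p : R := q%:R^-1 + q%:R ^- d * N.
have q_neq0 : q%:R != 0 :> R by rewrite pnatr_eq0 -lt0n odd_gt0.
have cardX : #|'rV[F]_d|%:R = q%:R ^+ d :> R.
  by rewrite card_mx q_card mul1n natrX.
(* The integer exponent [d%:Z - 1] is -1 when d = 0; splitting off q^-1 needs only that q is
   nonzero. *)
have sphere_density : q%:R ^ (d%:Z - 1) + N = q%:R ^+ d * p.
  by rewrite /p mulrDr mulVKf ?expf_neq0 // expfzDr // exprN1 -exprnP.
have E_card s : s \in S -> #|sphere_points A s|%:R = #|'rV[F]_d|%:R * p.
  by move=> sS; rewrite S_card // cardX.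
apply: le_trans (incidence_variance P E_card) _.
rewrite cardX -[in leRHS](mulrA #|P|%:R) -mulrDr [in leRHS]addrC.
apply: ler_wpM2l; first exact: ler0n.
set c := q%:R ^+ d * p ^+ 2; set m := _ + N.
(* The diagonal pairs contribute |S|(m - c), whereas the claimed bound has |S|m; the sign of [c]
   settles the difference. *)
have c_ge0 : 0 <= c by rewrite mulr_ge0 ?sqr_ge0 // exprn_ge0 ?ler0n.
have sum_diag : \sum_(s1 in S) \sum_(s2 in S)
      (#|sphere_points A s1 :&: sphere_points A s2|%:R - c) =
    #|S|%:R * (m - c) + \sum_(s1 in S) \sum_(s2 in S | s1 != s2)
      (#|sphere_points A s1 :&: sphere_points A s2|%:R - c).
  rewrite mulr_natl -sumr_const -big_split /=; apply: eq_bigr => s1 s1S.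
  rewrite (bigD1 s1) //= setIid S_card //; congr (_ + _).
  by apply: eq_bigl => s2; rewrite eq_sym.
have sum_const : \sum_(s1 in S) \sum_(s2 in S)
      (#|sphere_points A s1 :&: sphere_points A s2|%:R - c) =
    \sum_(s1 in S) \sum_(s2 in S)
      #|sphere_points A s1 :&: sphere_points A s2|%:R - c * #|S|%:R ^+ 2.
  under eq_bigr => s1 _ do rewrite sumrB sumr_const.
  by rewrite sumrB sumr_const -mulrnA expr2 -natrM mulr_natr.
rewrite -sum_const sum_diag lerD2r.
by apply: ler_wpM2l; rewrite ?ler0n // gerBl.
Qed.
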